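(* For every real $\alpha>0$ and every integer $k\ge 1$ there exist constants $C,c>0$ such that the following holds for all large enough integers $n$. Let $G_{\alpha}$ be a graph on $n$ vertices with $\delta(G_{\alpha})\geq \alpha n$, let $b\leq cn$ be a positive integer, and let $p\geq \frac{Cb}{n^2}$. Then with probability at least $1-\exp(-c pn^2)$ the following holds: in the $(1:b)$ Waiter-Client game played on the edges of $G_{\alpha}\cup G_{n,p}$, Waiter has a strategy to force Client to claim a spanning $k$-vertex-connected graph.
   Context: A $(1:b)$ Waiter-Client game on a board $X$ with winning sets $\mathcal{F}$: in every round Waiter picks $b+1$ previously unchosen elements of $X$ (possibly fewer in the last round) and offers them to Client; Client claims one of them and the rest go to Waiter. Waiter wins if Client claims all elements of some $F\in\mathcal{F}$. $G_{n,p}$ is the binomial random graph on the vertex set of $G_\alpha$; $G_\alpha\cup G_{n,p}$ is the union of edge sets. *)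

(* Defs.v *)
From mathcomp Require Import all_boot all_order all_algebra.
From mathcomp Require Import boolp reals.

Set Implicit Arguments.
Unset Strict Implicit.
Unset Printing Implicit Defensive.

Import Order.TTheory GRing.Theory Num.Theory.

Section WaiterClient.
Variable T : finType.

(* A history is the sequence of the elements claimed by Client so far, most
   recent first; it determines the position, since Waiter's offers are given
   by his strategy. *)
Definition strategy := seq T -> {set T}.

Implicit Types (X : {set T}) (F : {set {set T}}) (s : strategy) (h : seq T).

Fixpoint unchosen X s h : {set T} :=
  if h is _ :: h' then unchosen X s h' :\: s h' else X.

Fixpoint consistent s h : bool :=
  if h is x :: h' then consistent s h' && (x \in s h') else true.

(* Fewer than b + 1 elements are offered only when fewer remain, in which case
   all of them are offered; once the board is exhausted the offer is empty and
   no consistent history goes further. *)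
Definition legal_strategy X (b : nat) s : Prop :=
  forall h, consistent s h ->
    s h \subset unchosen X s h /\ #|s h| = minn b.+1 #|unchosen X s h|.

Definition waiter_wins X (b : nat) F : Prop :=
  exists2 s : strategy, legal_strategy X b s &
    forall h, consistent s h -> unchosen X s h = set0 ->
      exists2 A, A \in F & A \subset [set x in h].

End WaiterClient.

Section Graphs.
Variable V : finType.

(* A simple graph on the vertex set V is given by its edge set, a set of
   two-element subsets of V. *)
Definition vpairs : {set {set V}} := [set e : {set V} | #|e| == 2].

Definition is_graph (E : {set {set V}}) : bool := E \subset vpairs.

Definition degree (E : {set {set V}}) (v : V) : nat :=
  #|[set w | [set v; w] \in E]|.

Definition adj_minus (E : {set {set V}}) (S : {set V}) : rel V :=
  [rel u v | [&& u \notin S, v \notin S & [set u; v] \in E]].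

Definition k_connected (k : nat) (E : {set {set V}}) : bool :=
  (k < #|V|) &&
  [forall S : {set V}, (#|S| < k) ==>
    [forall u in ~: S, forall v in ~: S, connect (adj_minus E S) u v]].

Definition spanning_k_connected (X : {set {set V}}) (k : nat) :
    {set {set {set V}}} :=
  [set E : {set {set V}} | (E \subset X) && k_connected k E].

Local Open Scope ring_scope.

Definition Gnp_weight (R : realType) (p : R) (H : {set {set V}}) : R :=
  \prod_(e in vpairs) (if e \in H then p else 1 - p).

Definition Gnp_prob (R : realType) (p : R) (P : {set {set V}} -> Prop) : R :=
  \sum_(H : {set {set V}} | is_graph H && `[< P H >]) Gnp_weight p H.

End Graphs.

(* Main.v *)
Require Import Defs.
From mathcomp Require Import all_boot all_order all_algebra.
From mathcomp Require Import boolp reals sequences exp.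
From mathcomp Require Import ring lra zify.

(** Colour V with k colours so that every vertex has linearly many neighbours
    of each colour.  If Client's graph connects every colour class and joins
    every vertex to every other class, then it is k-connected, as fewer than k
    deleted vertices miss a colour.  Each class splits into boundedly many
    clusters of linear size whose cuts are all dense in G_alpha; with the
    stated probability any two clusters are joined by more than b edges of
    G_{n,p}, so Waiter can force an edge between any two clusters of the same
    class by offering such edges, and an edge from a vertex v to a class by
    offering edges at v.  To connect a cluster he repeatedly offers edges
    leaving a component of Client's graph.  While a component A is small, only
    edges owned by A are offered (each vertex owns linearly many edges, each
    edge has at most one owner): building A has used up at most (|A| - 1)(b + 1)
    of them, so more than b remain.  Once all components are large, the at most
    n(b + 1) edges offered so far are fewer than the edges of any cut. *)

Set Implicit Arguments.
Unset Strict Implicit.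
Unset Printing Implicit Defensive.

(** * Forcing positions and their strategies *)

Section Forcing.
Variables (T : finType) (b : nat) (Q : {set T} -> Prop).
Hypothesis Q_mono : forall A B : {set T}, A \subset B -> Q A -> Q B.
Implicit Types (U A S X : {set T}).

(** [U] is the unchosen board and [A] Client's set; a derivation is a tree of offers. Offers are
    always full: from a forcing position a shorter offer can only be due once [Q A] already
    holds. *)
Inductive forces : {set T} -> {set T} -> Prop :=
| forces_done U A : Q A -> forces U A
| forces_step U A S : S \subset U -> #|S| = b.+1 ->
    (forall x, x \in S -> forces (U :\: S) (x |: A)) -> forces U A.

Lemma subset_of_card U m : m <= #|U| -> exists2 S : {set T}, S \subset U & #|S| = m.
Proof.
move=> le_mU; exists [set x in take m (enum U)].
  by apply/subsetP=> x; rewrite inE => /mem_take; rewrite mem_enum.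
rewrite cardsE; have /card_uniqP -> : uniq (take m (enum U)).
  by rewrite take_uniq ?enum_uniq.
by rewrite size_takel -?cardE.
Qed.

Definition good_offer U A S : Prop :=
  [/\ S \subset U, #|S| = minn b.+1 #|U| &
      forall x, x \in S -> forces (U :\: S) (x |: A)].

Lemma forces_offer U A : forces U A -> exists S, good_offer U A S.
Proof.
case=> [U' A' QA|U' A' S sSU cS fS].
  have [S sSU cS] := subset_of_card (geq_minr b.+1 #|U'|).
  exists S; split=> // x _; apply: forces_done; apply: Q_mono QA.
  exact: subsetUr.
by exists S; split; rewrite // cS; apply/esym/minn_idPl; rewrite -cS subset_leq_card.
Qed.

Lemma forces_end A : forces set0 A -> Q A.
Proof.
have gen U A' : forces U A' -> U = set0 -> Q A'.
  case=> // U' A'' S sSU cS _ U0.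
  by move: sSU cS; rewrite U0 subset0 => /eqP ->; rewrite cards0.
by move=> /gen; apply.
Qed.

(* Once the goal is met the offers are arbitrary, hence a positional strategy
   on pairs (unchosen elements, elements claimed by Client) suffices. *)
Lemma forces_strategy X : forces X set0 ->
  exists2 s : strategy T, legal_strategy X b s &
    forall h, consistent s h -> unchosen X s h = set0 -> Q [set x in h].
Proof.
move=> fX.
have [o oP] : {o : {set T} * {set T} -> {set T} |
    forall z, forces z.1 z.2 -> good_offer z.1 z.2 (o z)}.
  have /choice [o oP] : forall z : {set T} * {set T}, exists S,
      forces z.1 z.2 -> good_offer z.1 z.2 S.
    move=> z; have [/forces_offer [S ?]|nf] := pselect (forces z.1 z.2).
      by exists S.
    by exists set0.
  by exists o.
pose st := fix st h := if h is x :: h' then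
  ((st h').1 :\: o (st h'), x |: (st h').2) else (X, set0).
pose s h := o (st h).
have st1 h : (st h).1 = unchosen X s h by elim: h => //= x h ->.
have st2 h : (st h).2 = [set x in h].
  by elim: h => [|x h /= ->]; apply/setP=> y; rewrite !inE.
have fst h : consistent s h -> forces (st h).1 (st h).2.
  elim: h => //= x h IHh /andP[/IHh /oP [_ _ fo]]; exact: fo.
exists s => [h /fst /oP [so co _]|h ch eU]; first by rewrite -st1.
by rewrite -st2; apply: forces_end; rewrite -eU -st1; apply: fst.
Qed.

(** Waiter offers [b.+1] elements of one box after another, and disjointness keeps the later boxes
    intact. The last hypothesis is a continuation: it receives the remaining board, which has lost
    only elements of boxes, and Client's set, which meets every box. *)
Lemma forces_boxes (I : eqType) (B : I -> {set T}) (s : seq I) U A :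
    uniq s -> {in s &, forall i j, i != j -> [disjoint B i & B j]} ->
    {in s, forall i, B i \subset U} -> {in s, forall i, b < #|B i|} ->
    (forall U' A', U' \subset U -> A \subset A' ->
       (forall e, e \in U -> e \notin U' -> exists2 i, i \in s & e \in B i) ->
       {in s, forall i, exists2 e, e \in B i & e \in A'} -> forces U' A') ->
  forces U A.
Proof.
elim: s U A => [|i s IHs] U A /=.
  by move=> _ _ _ _; apply=> // e ->.
move=> /andP[i_s us] dB sB cB fB.
have [S sSB cS] := subset_of_card (cB i (mem_head _ _)).
apply: (@forces_step U A S) => // [|x xS].
  exact: subset_trans sSB (sB i (mem_head _ _)).
have ss j : j \in s -> j \in i :: s by rewrite inE => ->; rewrite orbT.
apply: IHs => // [j k js ks|j js|j js|U' A' sU' sA' eU' mA'].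
- exact: dB (ss _ js) (ss _ ks).
- rewrite subsetD sB ?ss // (disjointWr sSB) // dB ?mem_head ?ss //.
  by apply: contraNneq i_s => <-.
- exact: cB (ss _ js).
apply: fB => [|||j].
- exact: subset_trans sU' (subsetDl _ _).
- exact: subset_trans (subsetUr _ _) sA'.
- move=> e eU neU'; have [eS|neS] := boolP (e \in S).
    by exists i; rewrite ?mem_head // (subsetP sSB).
  have [|j js ej] := eU' e _ neU'; first by rewrite inE neS.
  by exists j; rewrite ?ss.
rewrite inE => /predU1P[->|/mA' //].
exists x; first exact: (subsetP sSB).
by apply: (subsetP sA'); rewrite setU11.
Qed.

End Forcing.

(** * Connecting the clusters by merging components *)

Definition edge (V : finType) (z : V * V) : {set V} := [set z.1; z.2].

(** Pairs with the same vertex set are equal or reverses of each other; the hypothesis excludes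
    reverses, and loops with them. *)
Lemma edge_inj (V : finType) (Z : {set V * V}) :
    {in Z, forall z, (z.2, z.1) \notin Z} -> {in Z &, injective (@edge V)}.
Proof.
move=> asymZ [x y] [x' y'] xyZ xyZ' eq_e; rewrite /edge /= in eq_e.
have xe : x \in [set x'; y'] by rewrite -eq_e set21.
have ye : y \in [set x'; y'] by rewrite -eq_e set22.
have asym := asymZ _ xyZ.
have /set2P[ex|ex] : x' \in [set x; y] by rewrite eq_e set21.
  have /set2P[ey|ey] : y' \in [set x; y] by rewrite eq_e set22.
    by move: ye; rewrite ex ey !inE orbb => /eqP ->.
  by rewrite ex ey.
have /set2P[ey|ey] : y' \in [set x; y] by rewrite eq_e set22.
  by case/negP: asym; rewrite -ex -ey.
by move: xe; rewrite ex ey !inE orbb => /eqP ->.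
Qed.

Section Merging.
Variables (V L : finType) (b d : nat) (Q : {set {set V}} -> Prop).
Variables (G : {set {set V}}) (cl : V -> L) (D : rel V).
Implicit Types (U A S : {set {set V}}) (P R : {set V}) (f : V -> V).

Definition cluster_adj A : rel V := [rel u v | ([set u; v] \in A) && (cl u == cl v)].

Hypothesis Q_conn : forall A,
  (forall u v, cl u = cl v -> connect (cluster_adj A) u v) -> Q A.
Hypothesis D_sub : forall u v, D u v ->
  [&& [set u; v] \in G, cl u == cl v & ~~ D v u].
Hypothesis D_deg : forall u, d <= #|[set v | D u v]|.

Definition cross P R : {set V * V} := [set z | [&& z.1 \in P, z.2 \in R & edge z \in G]].

Lemma in_cross P R z :
  (z \in cross P R) = [&& z.1 \in P, z.2 \in R & edge z \in G].
Proof. by rewrite inE. Qed.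

(** A side counts as large once [d <= #|P| + b]. As merging never has more than [#|V| * b.+1] edges
    offered, the factor [#|V|.+1] leaves one full offer in the cut. *)
Hypothesis G_cut : forall P R a, P :|: R = [set v | cl v == a] ->
  [disjoint P & R] -> d <= #|P| + b -> d <= #|R| + b ->
  #|V|.+1 * b.+1 <= #|cross P R|.

Definition intra : {set {set V}} :=
  [set edge z | z in [set z : V * V | (edge z \in G) && (cl z.1 == cl z.2)]].

(** [D u v] is read as: [u] owns the edge [uv]. *)
Definition owned P : {set V * V} := [set z | (z.1 \in P) && D z.1 z.2].

(* Offered pairs of [Z]: an edge leaves [U] as soon as it is offered. *)
Definition used U (Z : {set V * V}) : {set V * V} := [set z in Z | edge z \notin U].

Definition comp f u : {set V} := [set v | f v == f u].

Definition merge f u v : V -> V := fun x => if f x == f u then f v else f x.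

(** Only one implication is kept: the classes of the labelling [f] may be finer than the components
    of Client's graph, so a claimed edge merges just the two classes of its ends. *)
Definition joined A f : Prop :=
  forall u v, f u = f v -> (cl u = cl v /\ connect (cluster_adj A) u v).

Lemma cluster_adj_sym A : symmetric (cluster_adj A).
Proof. by move=> u v; rewrite /cluster_adj /= setUC eq_sym. Qed.

Lemma joined_merge A f z : joined A f -> cl z.1 = cl z.2 ->
  joined (edge z |: A) (merge f z.1 z.2).
Proof.
move=> jf clz; pose A' := edge z |: A.
have cs : connect_sym (cluster_adj A').
  exact: sym_connect_sym (@cluster_adj_sym A').
have jf' u v : f u = f v -> cl u = cl v /\ connect (cluster_adj A') u v.
  case/jf=> -> c; split=> //; apply: connect_sub c => x y /= /andP[xy cxy].
  by apply: connect1; rewrite /cluster_adj /= inE xy orbT.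
have cz : connect (cluster_adj A') z.1 z.2.
  by apply: connect1; rewrite /cluster_adj /= setU11 clz eqxx.
move=> u v; rewrite /merge.
case: eqP => [/jf'[eu cu]|nu]; case: eqP => [/jf'[ev cv]|nv].
- move=> _; rewrite eu ev; split=> //; apply: connect_trans cu _.
  by rewrite cs.
- move=> /jf'[ev cv]; rewrite eu -ev clz; split=> //.
  exact: connect_trans cu (connect_trans cz cv).
- move=> /jf'[eu cu]; rewrite eu ev clz; split=> //.
  by apply: connect_trans cu _; rewrite cs; apply: connect_trans cv cz.
- exact: jf'.
Qed.

Lemma merge_codom f u v : f u != f v ->
  #|[set merge f u v x | x in V]| < #|[set f x | x in V]|.
Proof.
move=> nuv; apply: proper_card; apply/properP; split.
  apply/subsetP=> _ /imsetP[x _ ->]; rewrite /merge.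
  by case: ifP => _; apply: imset_f.
exists (f u); first exact: imset_f.
apply/imsetP => -[x _]; rewrite /merge; case: eqP => [_ /eqP|nx /esym //].
exact/negP.
Qed.

Lemma comp_merge f u v w : f u != f v ->
  comp (merge f u v) w =
    if (f w == f u) || (f w == f v) then comp f u :|: comp f v else comp f w.
Proof.
move=> nuv; apply/setP=> x; case: ifP => [fw|/norP[nu nv]]; rewrite !inE /merge.
  have -> : (if f w == f u then f v else f w) = f v.
    by case: ifP fw => //= _ /eqP.
  by case: (f x =P f u) => //=; rewrite eqxx.
rewrite (negPf nu); case: (f x =P f u) => [->|_] //.
by rewrite !(eq_sym _ (f w)) (negPf nu) (negPf nv).
Qed.

Lemma comp_disjoint f u v : f u != f v -> [disjoint comp f u & comp f v].
Proof.
move=> nuv; apply/pred0P=> x /=; rewrite !inE.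
by case: eqP => // ->; apply/negbTE.
Qed.

Lemma forces_edges U A (Z : {set V * V}) :
    {in Z, forall z, (z.2, z.1) \notin Z} -> #|Z| = b.+1 ->
    {in Z, forall z, edge z \in U} ->
    {in Z, forall z, forces b Q (U :\: [set edge z | z in Z]) (edge z |: A)} ->
  forces b Q U A.
Proof.
move=> asymZ cZ ZU fZ; apply: (@forces_step _ _ _ U A [set edge z | z in Z]).
- by apply/subsetP=> _ /imsetP[z zZ ->]; apply: ZU.
- by rewrite card_in_imset //; apply: edge_inj.
- by move=> _ /imsetP[z zZ ->]; apply: fZ.
Qed.

Lemma card_used_intra U (Z : {set V * V}) :
    {in Z, forall z, (z.2, z.1) \notin Z} ->
    {in Z, forall z, (edge z \in G) && (cl z.1 == cl z.2)} ->
  #|used U Z| <= #|intra :\: U|.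
Proof.
move=> asymZ Zi; have asym' : {in used U Z, forall z, (z.2, z.1) \notin used U Z}.
  by move=> z; rewrite !inE => /andP[zZ _]; rewrite (negPf (asymZ z zZ)).
rewrite -(card_in_imset (edge_inj asym')); apply/subset_leq_card/subsetP.
move=> e /imsetP[z]; rewrite inE => /andP[zZ zU] ->.
by rewrite inE zU; apply/imsetP; exists z; rewrite // inE Zi.
Qed.

(** The last hypothesis says that at most [b.+1] edges of [intra] were offered for each lost label.
    A class and the rest of its cluster are both large, so [G_cut] leaves a full offer between them,
    and whatever Client claims removes a label. *)
Lemma forces_merge_large m U A f : #|[set f x | x in V]| <= m ->
    joined A f -> (forall u, d <= #|comp f u| + b) ->
    #|intra :\: U| + #|[set f x | x in V]| * b.+1 <= #|V| * b.+1 ->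
  forces b Q U A.
Proof.
elim: m U A f => [|m IHm] U A f le_m jf large totU.
  (* No label means no vertex. *)
  apply: forces_done; apply: Q_conn => u v _.
  suff : 0 < #|[set f x | x in V]| by lia.
  by apply/card_gt0P; exists (f u); apply: imset_f.
have [/existsP[u /existsP[v /andP[/eqP cuv nuv]]]|] :=
    boolP [exists u, exists v, (cl u == cl v) && (f u != f v)]; last first.
  rewrite negb_exists => /forallP nf.
  apply: forces_done; apply: Q_conn => u v cuv.
  have := nf u; rewrite negb_exists => /forallP/(_ v).
  by rewrite cuv eqxx negbK => /eqP/jf[].
pose P := comp f u; pose R := [set w | cl w == cl u] :\: P.
have clP : P \subset [set w | cl w == cl u].
  by apply/subsetP=> w; rewrite !inE => /eqP/jf[->].
have vR : comp f v \subset R.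
  rewrite subsetD; apply/andP; split.
    by apply/subsetP=> w; rewrite !inE => /eqP/jf[->]; rewrite cuv.
  by rewrite disjoint_sym comp_disjoint.
have dPR : [disjoint P & R] by rewrite disjoint_sym -setI_eq0 setIDAC setDIl setDv setI0.
have cut : #|V|.+1 * b.+1 <= #|cross P R|.
  apply: (@G_cut P R (cl u) _ dPR (large u)).
    by apply: etrans (setID _ P); rewrite (setIidPr clP).
  by apply: leq_trans (large v) _; rewrite leq_add2r subset_leq_card.
have asymPR : {in cross P R, forall z, (z.2, z.1) \notin cross P R}.
  move=> z; rewrite !in_cross => /and3P[zP _ _]; apply/negP => /and3P[_ /=].
  by rewrite (disjointFr dPR zP).
have iPR : {in cross P R, forall z, (edge z \in G) && (cl z.1 == cl z.2)}.
  move=> z; rewrite in_cross => /and3P[/(subsetP clP) + + ->].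
  by rewrite !inE => /eqP -> /andP[_ /eqP ->] /=.
have cZ : b < #|cross P R :\: used U (cross P R)|.
  have := cardsID (used U (cross P R)) (cross P R).
  rewrite (setIidPr _); last by apply/subsetP=> z; rewrite inE => /andP[].
  have := card_used_intra U asymPR iPR; lia.
have [Z sZ cardZ] := subset_of_card cZ.
have ZP z : z \in Z -> z \in cross P R /\ edge z \in U.
  move/(subsetP sZ); rewrite in_setD in_set => /andP[+ zPR].
  by rewrite zPR negbK.
apply: (@forces_edges U A Z) => // [z zZ|z /ZP[] //|z zZ].
  have [zPR _] := ZP z zZ; apply: contra (asymPR z zPR) => /ZP[]//.
have [zPR zU] := ZP z zZ; have [zP zR] : z.1 \in P /\ z.2 \in R.
  by move: zPR; rewrite in_cross => /and3P[].
have nz : f z.1 != f z.2.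
  by move: zP zR; rewrite !inE => /eqP -> /andP[]; rewrite eq_sym.
have lt_im := merge_codom nz.
apply: (IHm _ _ (merge f z.1 z.2)).
- by rewrite -ltnS; apply: leq_trans lt_im le_m.
- by apply: joined_merge => //; case/andP: (iPR z zPR) => _ /eqP.
- move=> w; rewrite comp_merge //; case: ifP => // _.
  by apply: leq_trans (large z.1) _; rewrite leq_add2r subset_leq_card ?subsetUl.
have : #|intra :\: (U :\: [set edge z | z in Z])| <= #|intra :\: U| + b.+1.
  rewrite -cardZ; apply: leq_trans (leq_add (leqnn _) (leq_imset_card (@edge V) Z)).
  apply: leq_trans (leq_card_setU _ _); apply/subset_leq_card/subsetP=> e.
  by rewrite !inE => /andP[+ ->]; rewrite negb_and negbK andbT orbC.
(* The offer uses up at most [b.+1] edges and the merge pays for them with one label. *)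
move: lt_im totU; clear; nia.
Qed.

Lemma D_asym u v : D u v -> D v u = false.
Proof. by move/D_sub => /and3P[_ _ /negPf]. Qed.

Lemma card_owned P : #|P| * d <= #|owned P|.
Proof.
rewrite -[X in _ <= X]sum1_card (eq_bigl (fun z => (z.1 \in P) && D z.1 z.2)); last first.
  by move=> z; rewrite inE.
rewrite -(pair_big_dep (mem P) D (fun _ _ => 1)) /= -sum_nat_const.
apply: leq_sum => u _; rewrite sum1_card; apply: leq_trans (D_deg u) _.
by rewrite leq_eqVlt; apply/orP; left; apply/eqP/eq_card => v; rewrite inE.
Qed.

(** As an edge has at most one owner, an offer counts only against the classes that own its
    pairs. *)
Lemma used_offer U P (Z : {set V * V}) : {in Z, forall z, D z.1 z.2} ->
  used (U :\: [set edge z | z in Z]) (owned P) \subset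
    used U (owned P) :|: (Z :&: owned P).
Proof.
move=> ZD; apply/subsetP=> z; rewrite !inE => /andP[/andP[zP zD]].
rewrite zP zD /= negb_and negbK orbC => /orP[->//|/imsetP[z' z'Z eqz]].
have asym : {in owned [set: V], forall z, (z.2, z.1) \notin owned [set: V]}.
  by move=> x; rewrite !inE /= => /D_asym ->.
rewrite (edge_inj asym _ _ eqz) ?z'Z ?orbT // inE ?inE ?zD //.
exact: ZD.
Qed.

(** The hypothesis on [used] bounds by [(#|P| - 1) * b.+1] the used pairs owned by a class [P]. Once
    no class is small, [forces_merge_large] takes over. *)
Lemma forces_merge_owned m U A f : #|[set f x | x in V]| <= m ->
    joined A f ->
    (forall u, #|used U (owned (comp f u))| + b.+1 <= #|comp f u| * b.+1) ->
    #|intra :\: U| + #|[set f x | x in V]| * b.+1 <= #|V| * b.+1 ->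
  forces b Q U A.
Proof.
elim: m U A f => [|m IHm] U A f le_m jf own totU.
  apply: forces_done; apply: Q_conn => u v _.
  suff : 0 < #|[set f x | x in V]| by lia.
  by apply/card_gt0P; exists (f u); apply: imset_f.
have [/existsP[u small]|] := boolP [exists u, #|comp f u| + b < d]; last first.
  rewrite negb_exists => /forallP nsmall.
  by apply: forces_merge_large le_m jf _ totU => u; rewrite leqNgt.
set P := comp f u in small.
pose Z := [set z in owned P | (z.2 \notin P) && (edge z \in U)].
(* [P] owns at least [#|P| * d] pairs, of which at most [#|P| * #|P|] stay inside and at most
   [(#|P| - 1) * b.+1] are used. Since [d - #|P| > b], more than [b] remain. *)
have cZ : b < #|Z|.
  have : #|owned P| <= #|Z| + #|used U (owned P)| + #|P| * #|P|.
    rewrite -cardsX; apply: leq_trans (leq_add (leq_card_setU _ _) (leqnn _)).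
    apply: leq_trans (leq_card_setU _ _); apply/subset_leq_card/subsetP=> z.
    rewrite !inE => /andP[-> ->] /=.
    by case: (_ == _); case: (_ \in U).
  have := card_owned P; have := own u; rewrite -/P; nia.
have [Z0 sZ cardZ] := subset_of_card cZ.
have ZP z : z \in Z0 -> [/\ z.1 \in P, D z.1 z.2, z.2 \notin P & edge z \in U].
  by move/(subsetP sZ); rewrite /Z !in_set => /andP[/andP[-> ->] /andP[-> ->]].
have ZD : {in Z0, forall z, D z.1 z.2} by move=> z /ZP[].
apply: (@forces_edges U A Z0) => // [z /ZP[_ zD _ _]|z /ZP[] //|z zZ].
  by apply/negP=> /ZP[_] /=; rewrite D_asym.
have [zP zD zR zU] := ZP z zZ.
have eqP1 : comp f z.1 = P.
  by move: zP; rewrite inE => /eqP ez; rewrite /P /comp ez.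
have nz : f z.1 != f z.2.
  by move: zP zR; rewrite !inE => /eqP ->; rewrite eq_sym.
have lt_im := merge_codom nz.
apply: (IHm _ _ (merge f z.1 z.2)).
- by rewrite -ltnS; apply: leq_trans lt_im le_m.
- by apply: joined_merge => //; have /and3P[_ /eqP] := D_sub zD.
- move=> w; rewrite comp_merge //; case: ifP => [_|/norP[nw1 _]].
    (* Budgets add up: for classes of sizes [x] and [y], the two allowances and the present offer
       make [(x - 1) + (y - 1) + 1] times [b.+1]. *)
    have := leq_card_setU (comp f z.1) (comp f z.2).
    rewrite cardsU (disjoint_setI0 (comp_disjoint nz)) cards0 subn0 => _.
    have := own z.1; have := own z.2.
    have := subset_leq_card (used_offer U (comp f z.1 :|: comp f z.2) ZD).
    have : #|used U (owned (comp f z.1 :|: comp f z.2)) :|: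
             Z0 :&: owned (comp f z.1 :|: comp f z.2)| <=
           #|used U (owned (comp f z.1))| + #|used U (owned (comp f z.2))| + b.+1.
      rewrite -cardZ; apply: leq_trans (leq_add (leq_card_setU _ _) (leqnn _)).
      apply: leq_trans (leq_card_setU _ _); apply/subset_leq_card/subsetP=> x.
      rewrite !inE; case: (x \in Z0) => /=; rewrite ?orbT //.
      by rewrite !(andb_orl, orbF).
    nia.
  apply: leq_trans (own w); rewrite leq_add2r.
  apply: leq_trans (subset_leq_card (used_offer U (comp f w) ZD)) _.
  rewrite (_ : Z0 :&: _ = set0) ?setU0 //; apply/setP=> x; rewrite !inE.
  apply/negP=> /andP[/ZP[xP _ _ _] /andP[/eqP xw _]].
  move: nw1 xP zP; rewrite !inE -xw => /eqP nx /eqP e1 /eqP e2.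
  by case: nx; rewrite e1 e2.
have : #|intra :\: (U :\: [set edge z | z in Z0])| <= #|intra :\: U| + b.+1.
  rewrite -cardZ; apply: leq_trans (leq_add (leqnn _) (leq_imset_card (@edge V) Z0)).
  apply: leq_trans (leq_card_setU _ _); apply/subset_leq_card/subsetP=> e.
  by rewrite !inE => /andP[+ ->]; rewrite negb_and negbK andbT orbC.
move: lt_im totU; clear; nia.
Qed.

Lemma forces_merge U A : intra \subset U -> forces b Q U A.
Proof.
move=> sIU; have usedI : intra :\: U = set0 by apply/eqP; rewrite setD_eq0.
apply: (@forces_merge_owned #|V| U A id).
- exact: leq_imset_card.
- by move=> u v ->; split.
- move=> u; have -> : comp id u = [set u] by apply/setP=> v; rewrite !inE.
  rewrite cards1 mul1n (_ : used _ _ = set0) ?cards0 //.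
  apply/setP=> z; rewrite !inE; apply/negP=> /andP[/andP[_ zD] /negP[]].
  apply: (subsetP sIU); apply/imsetP; exists z => //.
  by rewrite inE; have /and3P[-> ->] := D_sub zD.
by rewrite usedI cards0 add0n leq_mul2r leq_imset_card orbT.
Qed.

End Merging.

(** * From forcing to connectivity *)

Lemma forces_weaken (T : finType) b (Q : {set T} -> Prop) (A0 U A : {set T}) :
  forces b (fun B => A0 \subset B -> Q B) U A -> A0 \subset A -> forces b Q U A.
Proof.
elim=> {}U {}A => [QA sA|S sSU cS _ IH sA]; first by apply: forces_done; apply: QA.
by apply: forces_step sSU cS _ => x xS; apply: IH; rewrite // subsetU ?sA ?orbT.
Qed.

Lemma legal_subset (T : finType) (X : {set T}) b s h :
  legal_strategy X b s -> consistent s h -> [set x in h] \subset X.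
Proof.
move=> legal; elim: h => [_|x h IHh /= /andP[ch xs]].
  by apply/subsetP=> x; rewrite inE.
have sU : unchosen X s h \subset X.
  elim: h {IHh ch xs} => //= y h; apply: subset_trans; exact: subsetDl.
rewrite set_cons subUset IHh // sub1set andbT.
by apply: (subsetP sU); apply: (subsetP (legal h ch).1).
Qed.

Section Connectivity.
Variable V : finType.
Implicit Types (E : {set {set V}}) (S : {set V}).

Lemma k_connected_mono k E E' : E \subset E' -> k_connected k E -> k_connected k E'.
Proof.
rewrite /k_connected => sE /andP[-> /forallP kE]; apply/forallP=> S; apply/implyP=> cS.
apply/forall_inP=> u uS; apply/forall_inP=> v vS.
have := kE S; rewrite cS => /forall_inP/(_ u uS)/forall_inP/(_ v vS).
apply: connect_sub => x y /and3P[xS yS xy].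
by apply: connect1; rewrite /adj_minus /= xS yS (subsetP sE).
Qed.

(* A set of fewer than [k] vertices misses a colour class, which stays
   connected and keeps a neighbour of every other vertex. *)
Lemma k_connected_of_colours k (chi : V -> 'I_k) E : k < #|V| ->
    (forall u v, chi u = chi v -> connect (cluster_adj chi E) u v) ->
    (forall u l, l != chi u -> exists2 v, chi v = l & [set u; v] \in E) ->
  k_connected k E.
Proof.
move=> kV conn dom; rewrite /k_connected kV; apply/forallP=> S; apply/implyP=> cS.
have [l lS] : exists l, l \notin chi @: S.
  apply/existsP; rewrite -negb_forall; apply/negP => /forallP all_l.
  have : #|'I_k| <= #|chi @: S| by apply/subset_leq_card/subsetP => l _.
  by rewrite card_ord leqNgt (leq_ltn_trans (leq_imset_card _ _)).
have lN v : chi v = l -> v \notin S.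
  by move=> vl; apply: contra lS => vS; rewrite -vl imset_f.
have sym : connect_sym (adj_minus E S).
  by apply: sym_connect_sym => u v; rewrite /adj_minus /= setUC andbCA.
have to_l u : u \notin S -> exists2 v, chi v = l & connect (adj_minus E S) u v.
  move=> uS; have [ul|nul] := eqVneq l (chi u); first by exists u.
  have [v vl uv] := dom u l nul; exists v => //.
  by apply: connect1; rewrite /adj_minus /= uS uv lN.
have in_l u v : chi u = l -> chi v = l -> connect (adj_minus E S) u v.
  move=> ul vl; have /connectP[p] := conn u v (etrans ul (esym vl)).
  elim: p u ul => [|w p IHp] u ul /= => [_ -> //|/andP[/andP[uw /eqP cuw] pw] ev].
  apply: connect_trans (connect1 _) (IHp w _ pw ev); last by rewrite -cuw.
  by rewrite /adj_minus /= !lN // -cuw.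
apply/forall_inP=> u; rewrite inE => uS; apply/forall_inP=> v; rewrite inE => vS.
have [u' u'l cu] := to_l u uS; have [v' v'l cv] := to_l v vS.
apply: connect_trans cu (connect_trans (in_l _ _ u'l v'l) _).
by rewrite sym.
Qed.

End Connectivity.

(** * Waiter's strategy on a clustered graph *)

Section WaiterStrategy.
Variables (V L : finType) (k b d : nat) (G X : {set {set V}}).
Variables (chi : V -> 'I_k) (cl : V -> L) (D : rel V).
Hypothesis kV : k < #|V|.
Hypothesis sGX : G \subset X.
Hypothesis X_graph : is_graph X.
Hypothesis D_sub : forall u v, D u v -> ([set u; v] \in G) && ~~ D v u.
Hypothesis cl_chi : forall u v, cl u = cl v -> chi u = chi v.
Hypothesis D_colour : forall u l, b < #|[set v | D u v && (chi v == l)]|.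
Hypothesis D_cluster : forall u, d <= #|[set v | D u v && (cl u == cl v)]|.
Hypothesis G_cut : forall (P R : {set V}) a, P :|: R = [set v | cl v == a] ->
  [disjoint P & R] -> d <= #|P| + b -> d <= #|R| + b ->
  #|V|.+1 * b.+1 <= #|cross G P R|.
Hypothesis X_cross : forall u v, cl u <> cl v -> chi u = chi v ->
  b < #|[set e in X | cl @: e == [set cl u; cl v]]|.

(** Boxes of the first stage. Admitting only edges owned by [i.1] keeps the boxes at the two ends of
    an edge disjoint. *)
Let star (i : V * 'I_k) : {set {set V}} :=
  [set edge z | z in [set z : V * V | [&& z.1 == i.1, D z.1 z.2 & chi z.2 == i.2]]].
Let stars := enum [pred i : V * 'I_k | i.2 != chi i.1].
(** Boxes of the second stage. Indexing by the set of both labels makes boxes with distinct indices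
    disjoint. *)
Let between (j : {set L}) : {set {set V}} := [set e in X | cl @: e == j].
Let pairs := enum [set [set cl z.1; cl z.2] | z in
  [set z : V * V | (cl z.1 != cl z.2) && (chi z.1 == chi z.2)]].

Lemma D_edge_inj : {in [set z : V * V | D z.1 z.2] &, injective (@edge V)}.
Proof.
apply: edge_inj => z; rewrite !inE /=.
by case/D_sub/andP.
Qed.

(** This lemma and the next separate the stages: star edges change colour, while edges of [between]
    change cluster but not colour. Each stage thus finds its edges unchosen. *)
Let star_colour i e u v : i \in stars -> e \in star i -> e = [set u; v] ->
  chi u != chi v.
Proof.
rewrite mem_enum inE => ni /imsetP[z]; rewrite inE => /and3P[/eqP zi zD /eqP zl] ->.
move: ni; rewrite -zi -zl => nz ez.
have: z.1 \in [set u; v] by rewrite -ez set21.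
have: z.2 \in [set u; v] by rewrite -ez set22.
by case/set2P=> e2; case/set2P=> e1; move: nz; rewrite e1 e2 ?eqxx // eq_sym.
Qed.

Let between_cl j e u v : j \in pairs -> e \in between j -> e = [set u; v] ->
  chi u = chi v /\ cl u <> cl v.
Proof.
rewrite mem_enum => /imsetP[z]; rewrite inE => /andP[/eqP ncl /eqP echi] ->.
rewrite inE => /andP[_ /eqP + ee]; rewrite ee imsetU1 imset_set1 => ecl.
have u2 : cl u \in [set cl z.1; cl z.2] by rewrite -ecl set21.
have v2 : cl v \in [set cl z.1; cl z.2] by rewrite -ecl set22.
have z1 : cl z.1 \in [set cl u; cl v] by rewrite ecl set21.
have z2 : cl z.2 \in [set cl u; cl v] by rewrite ecl set22.
split.
  by case/set2P: u2 => /cl_chi ->; case/set2P: v2 => /cl_chi ->.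
move=> euv; move: z1 z2; rewrite euv !inE !orbb => /eqP e1 /eqP e2.
by case: ncl; rewrite e1.
Qed.

Let edgeP e : e \in X -> exists u v, e = [set u; v].
Proof.
move/(subsetP X_graph); rewrite inE => /cards2P[u [v [_ ->]]].
by exists u, v.
Qed.

Lemma waiter_wins_of_clusters : waiter_wins X b (spanning_k_connected X k).
Proof.
suff /forces_strategy : forces b (k_connected k) X set0.
  case=> [A B|s legal win]; first exact: k_connected_mono.
  exists s => // h ch Uh; exists [set x in h] => //.
  by rewrite inE (legal_subset legal ch) win.
have starX i : star i \subset X.
  apply/subsetP=> _ /imsetP[z + ->]; rewrite inE => /and3P[_ /D_sub/andP[zG _] _].
  exact: (subsetP sGX).
apply: (@forces_boxes _ _ _ _ star stars) => //.
- exact: enum_uniq.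
- move=> i j _ _ nij; apply/pred0P=> e /=; apply/negP.
  case/andP=> /imsetP[z + ->] /imsetP[z' + eqe].
  rewrite !inE => /and3P[/eqP zi zD /eqP zl] /and3P[/eqP zi' zD' /eqP zl'].
  have eqz : z = z' by apply: D_edge_inj eqe; rewrite inE.
  case/eqP: nij; move: zi' zl'; rewrite -eqz zi zl => e1 e2.
  by rewrite (surjective_pairing i) e1 e2 -surjective_pairing.
- move=> [u l] _; rewrite card_in_imset; last first.
    move=> z z'; rewrite !inE => /and3P[_ zD _] /and3P[_ zD' _].
    by apply: D_edge_inj; rewrite inE.
  apply: leq_trans (D_colour u l) _.
  rewrite -(card_imset _ (_ : injective (fun v => (u, v)))); last by move=> ? ? [].
  apply/subset_leq_card/subsetP=> _ /imsetP[v + ->].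
  by rewrite !inE /= eqxx.
move=> U1 A1 sU1 _ eU1 mA1.
apply: (@forces_boxes _ _ _ _ between pairs) => //.
- exact: enum_uniq.
- move=> i j _ _ nij; apply/pred0P=> e /=; rewrite !inE; apply/negP.
  by case/andP=> /andP[_ /eqP ei] /andP[_ /eqP ej]; case/eqP: nij; rewrite -ei.
- move=> j jp; apply/subsetP=> e ej; have eX : e \in X.
    by move: ej; rewrite inE => /andP[].
  apply: contraT => neU; have [i ist ei] := eU1 e eX neU.
  have [u [v ee]] := edgeP eX.
  by have := star_colour ist ei ee; have [-> _] := between_cl jp ej ee; rewrite eqxx.
- move=> j; rewrite mem_enum => /imsetP[z]; rewrite inE => /andP[/eqP ncl /eqP echi] ->.
  exact: X_cross.
move=> U2 A2 sU2 sA12 eU2 mA2.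
(* [A2] stays in Client's set, so the goal of this last stage may presuppose the edges won in the
   first two. *)
apply: (forces_weaken (A0 := A2)) => //.
apply: (@forces_merge V L b d _ G cl (fun u v => D u v && (cl u == cl v))).
- move=> A clA sA2; apply: (k_connected_of_colours (chi := chi)) => // [u v euv|u l nul].
    have clA' x y : cl x = cl y -> connect (cluster_adj chi A) x y.
      move/clA; apply: connect_sub => {}x {}y /andP[xy /eqP/cl_chi exy].
      by apply: connect1; rewrite /cluster_adj /= xy exy eqxx.
    (* Different clusters of one colour are linked through the claimed edge [e], whose ends may come
       in either order. *)
    have [/clA' //|/eqP ncl] := eqVneq (cl u) (cl v).
    pose j := [set cl u; cl v].
    have jp : j \in pairs.
      rewrite mem_enum; apply/imsetP; exists (u, v) => //.
      by rewrite inE /= euv eqxx andbT; apply/eqP.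
    have [e ej eA2] := mA2 j jp.
    have /andP[eX /eqP ecl] : (e \in X) && (cl @: e == j) by move: ej; rewrite inE.
    have [x [y ee]] := edgeP eX.
    have [exy nxy] := between_cl jp ej ee.
    have adj_xy : cluster_adj chi A x y.
      by rewrite /cluster_adj /= -ee (subsetP sA2) // exy eqxx.
    have adj_yx : cluster_adj chi A y x by rewrite cluster_adj_sym.
    move: ecl; rewrite ee imsetU1 imset_set1 => ecl.
    have /set2P[ux|uy] : cl u \in [set cl x; cl y] by rewrite ecl set21.
      have /set2P[vx|vy] : cl v \in [set cl x; cl y] by rewrite ecl set22.
        by case: ncl; rewrite ux.
      apply: connect_trans (clA' _ _ ux) _; apply: connect_trans (connect1 adj_xy) _.
      by apply: clA'.
    have /set2P[vx|vy] : cl v \in [set cl x; cl y] by rewrite ecl set22.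
      apply: connect_trans (clA' _ _ uy) _; apply: connect_trans (connect1 adj_yx) _.
      by apply: clA'.
    by case: ncl; rewrite uy.
  have [|e /imsetP[z + ->] eA1] := mA1 (u, l); first by rewrite mem_enum.
  rewrite inE /= => /and3P[/eqP zu zD /eqP zl]; exists z.2 => //.
  by rewrite -zu; apply: (subsetP sA2); apply: (subsetP sA12).
- by move=> u v /andP[/D_sub/andP[-> /negPf ->] ->].
- exact: D_cluster.
- exact: G_cut.
apply/subsetP=> e /imsetP[z + ee]; rewrite inE => /andP[zG /eqP ecl].
have eX : e \in X by rewrite ee (subsetP sGX).
have eU1' : e \in U1.
  apply: contraT => /(eU1 e eX)[i ist ei].
  by have := star_colour ist ei ee; rewrite (cl_chi ecl) eqxx.
apply: contraT => /(eU2 e eU1')[j jp ej].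
by have [_] := between_cl jp ej ee.
Qed.

End WaiterStrategy.

Import Order.TTheory GRing.Theory Num.Theory.
Local Open Scope ring_scope.

(** * Exponential estimates *)

Section Exponential.
Variable R : realType.
Implicit Types x : R.

(** Powers of one half will replace exponentials because their averages can be computed exactly;
    [expR 1 >= 2] allows the passage. *)
Lemma expRN_le_half_expn m x : m%:R <= x -> expR (- x) <= 2^-1 ^+ m.
Proof.
move=> le_mx; rewrite exprVn expRN lef_pV2 ?posrE ?expR_gt0 ?exprn_gt0 ?ltr0n //.
apply: le_trans (_ : expR m%:R <= _); last by rewrite ler_expR.
rewrite -[m%:R]mulr1 expRM_natl lerXn2r ?nnegrE ?expR_ge0 ?ler0n //.
by apply: le_trans (expR_ge1Dx _).
Qed.

Lemma expr_onem_le_expR x m : x <= 1 -> (1 - x) ^+ m <= expR (- (x * m%:R)).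
Proof.
move=> x1; rewrite -mulNr mulrC expRM_natl lerXn2r ?nnegrE ?expR_ge0 ?subr_ge0 //.
exact: expR_ge1Dx.
Qed.

Lemma eventually_mulrn_lt_expR (delta : R) (K : nat) : 0 < delta ->
  exists N : nat, forall n, (N <= n)%N -> K%:R * n%:R < expR (delta * n%:R).
Proof.
(* The quadratic term of the exponential suffices: [delta ^+ 2 * n ^+ 2 / 2 > K * n] once
   [n > B]. *)
move=> d0; pose B := 2 * K%:R / delta ^+ 2.
have B0 : 0 <= B by rewrite /B divr_ge0 ?exprn_ge0 ?(ltW d0) // mulr_ge0.
exists (Num.bound B) => n le_Bn.
have ltBn : B < n%:R by apply: lt_le_trans (archi_boundP B0) _; rewrite ler_nat.
apply: lt_le_trans (expR_ge1Dxn 1 (mulr_ge0 (ltW d0) (ler0n _ n))).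
have K_lt : 2 * K%:R < delta ^+ 2 * n%:R.
  by move: ltBn; rewrite /B ltr_pdivrMr ?exprn_gt0 // [n%:R * _]mulrC.
have n0 := ler0n R n.
have -> : (2`!)%:R = 2 :> R by [].
nra.
Qed.

End Exponential.

(** * Balanced colourings by the first moment method *)

Section Colouring.
Variables (R : realType) (V I : finType) (F : I -> {set V}) (m : nat).
Local Notation M := (m.+1%:R : R).
Local Notation col chi i c := (F i :&: [set v | chi v == c]).

(** By independence the sum is a product over vertices: a vertex of [F i] contributes [M - 1 / 2],
    any other [M]. *)
Lemma sum_half_expn_colour (i : I) (c : 'I_m.+1) :
  \sum_(chi : {ffun V -> 'I_m.+1}) (2^-1 : R) ^+ #|col chi i c| =
    M ^+ #|V| * (1 - (2 * M)^-1) ^+ #|F i|.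
Proof.
pose h v a : R := if (v \in F i) && (a == c) then 2^-1 else 1.
transitivity (\sum_(chi : {ffun V -> 'I_m.+1}) \prod_v h v (chi v)).
  apply: eq_bigr => chi _; rewrite -big_mkcond prodr_const.
  by congr (_ ^+ _); apply: eq_card => v; rewrite !inE.
rewrite -bigA_distr_bigA.
transitivity (\prod_(v : V) (M * (if v \in F i then 1 - (2 * M)^-1 else 1))).
  apply: eq_bigr => v _; rewrite /h; case: (v \in F i) => /=; last first.
    by rewrite sumr_const card_ord mulr1.
  rewrite (bigD1 c) //= eqxx.
  rewrite (eq_bigr (fun _ => 1)); last by move=> a /negPf ->.
  rewrite sumr_const cardC1 card_ord /= -[M]natr1; field.
  by rewrite natr1 pnatr_eq0.
by rewrite big_split /= prodr_const -big_mkcond prodr_const.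
Qed.

(** Exponential Markov inequality with a union bound: a bad colouring has potential at least
    [expR (- t)], but the average potential is smaller. *)
Lemma colouring_of_potential t :
    (forall i, (#|I| * m.+1)%:R * (1 - (2 * M)^-1) ^+ #|F i| < expR (- t)) ->
  exists chi : V -> 'I_m.+1, forall i c, t <= #|col chi i c|%:R.
Proof.
move=> pot; have [//|nchi] := pselect (exists chi : V -> 'I_m.+1,
  forall i c, t <= #|col chi i c|%:R).
have bad (chi : {ffun V -> 'I_m.+1}) :
    expR (- t) <= \sum_i \sum_c (2^-1 : R) ^+ #|col chi i c|.
  apply: contrapT => nle; apply: nchi; exists chi => i c; rewrite leNgt.
  apply/negP => lt_t; apply: nle.
  apply: le_trans (expRN_le_half_expn (ltW lt_t)) _.
  rewrite (bigD1 i) //= (bigD1 c) //= -addrA lerDl addr_ge0 //.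
    by apply: sumr_ge0 => *; rewrite exprn_ge0 ?invr_ge0 ?ler0n.
  by apply: sumr_ge0 => *; apply: sumr_ge0 => *; rewrite exprn_ge0 ?invr_ge0 ?ler0n.
have MV : 0 < M ^+ #|V| by rewrite exprn_gt0 ?ltr0n.
have : \sum_(chi : {ffun V -> 'I_m.+1}) expR (- t) <=
    \sum_(chi : {ffun V -> 'I_m.+1}) \sum_i \sum_c (2^-1 : R) ^+ #|col chi i c|.
  exact: ler_sum.
rewrite sumr_const card_ffun card_ord exchange_big /=.
under eq_bigr => i _.
  rewrite exchange_big /=; under eq_bigr do rewrite sum_half_expn_colour.
  rewrite sumr_const card_ord; over.
move=> le_sum.
have [i0|I0] := pickP (fun i : I => true); last first.
  exfalso; move: le_sum; rewrite big1; last by move=> i; have := I0 i.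
  by rewrite leNgt -mulr_natr mulr_gt0 ?expR_gt0 // natrX.
have I_gt0 : (0 < #|I|)%N by apply/card_gt0P; exists i0.
exfalso; move: le_sum; apply/negP; rewrite -ltNge.
have IR : 0 < #|I|%:R :> R by rewrite ltr0n.
apply: (@lt_le_trans _ _ (\sum_(i : I) (M ^+ #|V| * expR (- t) / #|I|%:R))).
  apply: ltr_sum => [|i _]; first by apply/hasP; exists i0; rewrite ?mem_index_enum.
  rewrite ltr_pdivlMr // -[X in X * _]mulr_natr -mulrA -mulrA ltr_pM2l //.
  by rewrite -mulrA mulrC [M * #|I|%:R]mulrC; have := pot i; rewrite natrM.
rewrite sumr_const -[X in X <= _]mulr_natr divfK ?gt_eqF //.
by rewrite -[X in _ <= X]mulr_natr natrX mulrC.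
Qed.

End Colouring.

Lemma balanced_colouring (R : realType) (gamma : R) (K m : nat) : 0 < gamma ->
  exists2 delta : R, 0 < delta <= gamma & exists N : nat, forall n, (N <= n)%N ->
    forall (V I : finType) (F : I -> {set V}), (#|I| <= K * n)%N ->
      (forall i, gamma * n%:R <= #|F i|%:R) ->
    exists chi : V -> 'I_m.+1, forall i c,
      delta * n%:R <= #|F i :&: [set v | chi v == c]|%:R.
Proof.
move=> g0; pose M : R := m.+1%:R; have M1 : 1 <= M by rewrite ler1n.
have M0 : 0 < 4 * M by lra.
(* The power in the potential is at most [expR (- (2 * delta * n))]: half of the exponent beats the
   linear number of events, the other half is the bound sought. *)
pose delta := gamma / (4 * M).
have d0 : 0 < delta by rewrite divr_gt0.
have dM : gamma = 4 * M * delta by rewrite mulrC divfK ?gt_eqF.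
have dg : delta <= gamma by nra.
exists delta; first by rewrite d0.
have [N NP] := eventually_mulrn_lt_expR (K * m.+1) d0; exists N => n leNn V I F cI dF.
apply: colouring_of_potential => i.
have n0 := ler0n R n.
have M2 : (2 * M)^-1 <= 1 by rewrite invf_le1; lra.
apply: (@le_lt_trans _ _ ((K * m.+1)%:R * n%:R * expR (- (2 * delta * n%:R)))).
  apply: ler_pM; rewrite ?ler0n ?exprn_ge0 ?subr_ge0 //.
    by rewrite -natrM ler_nat mulnAC leq_mul2r cI orbT.
  apply: le_trans (expr_onem_le_expR _ M2) _; rewrite ler_expR lerN2 -/M.
  rewrite [leRHS]mulrC ler_pdivlMr; last by lra.
  apply: le_trans (dF i); rewrite dM; nra.
rewrite (_ : - (2 * delta * n%:R) = - (delta * n%:R) - delta * n%:R); last by ring.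
rewrite expRD mulrA gtr_pMl ?expR_gt0 // expRN ltr_pdivrMr ?expR_gt0 // mul1r.
exact: NP.
Qed.

(** * Clusters without sparse cuts *)

Section Clustering.
Variables (R : realFieldType) (V : finType) (g : rel V) (theta : R).
Hypothesis g_sym : symmetric g.
Implicit Types (P Q : {set V}) (f : {ffun V -> option V}).

Let w u v : R := (g u v)%:R - theta.
Let W P Q : R := \sum_(u in P) \sum_(v in Q) w u v.
Let cluster f a : {set V} := [set v | f v == a].
Let score f : R := \sum_u \sum_v (f u == f v)%:R * w u v.

Let W_card P Q :
  W P Q = #|[set z : V * V | [&& z.1 \in P, z.2 \in Q & g z.1 z.2]]|%:R
          - theta * #|P|%:R * #|Q|%:R.
Proof.
rewrite /W (eq_bigr (fun u => \sum_(v in Q) (g u v)%:R - theta *+ #|Q|)); last first.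
  by move=> u _; rewrite sumrB sumr_const.
rewrite sumrB sumr_const; congr (_ - _); last first.
  by rewrite -[LHS]mulr_natr -[X in X * _ = _]mulr_natr mulrAC.
rewrite pair_big_dep -sum1_card natr_sum [LHS]big_mkcond [RHS]big_mkcond /=.
apply: eq_bigr => -[u v] _; rewrite inE /=.
by case: (u \in P); case: (v \in Q); case: (g u v).
Qed.

Let WC P Q : W P Q = W Q P.
Proof.
by rewrite /W exchange_big /=; do 2![apply: eq_bigr => ? _]; rewrite /w g_sym.
Qed.

Let W_indic P Q : W P Q = \sum_u \sum_v ((u \in P) && (v \in Q))%:R * w u v.
Proof.
rewrite /W big_mkcond; apply: eq_bigr => u _; case: (u \in P) => /=; last first.
  by rewrite big1 // => v _; rewrite mul0r.
rewrite big_mkcond; apply: eq_bigr => v _.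
by case: (v \in Q); rewrite ?mul1r ?mul0r.
Qed.

Let score_diff f f' P Q :
    (forall u v, (f u == f v)%:R - (f' u == f' v)%:R =
      ((u \in P) && (v \in Q))%:R + ((u \in Q) && (v \in P))%:R :> R) ->
  score f - score f' = 2 * W P Q.
Proof.
move=> eq_ff'; have -> : 2 * W P Q = W P Q + W Q P by rewrite -WC; ring.
rewrite 2!W_indic -sumrB -big_split; apply: eq_bigr => u _ /=.
rewrite -sumrB -big_split; apply: eq_bigr => v _ /=.
by rewrite -mulrBl eq_ff' mulrDl.
Qed.

Let optimal f := forall f', score f' <= score f.

Let split_ge0 f P Q a : optimal f -> P :|: Q = cluster f a ->
  [disjoint P & Q] -> 0 <= W P Q.
Proof.
move=> opt eq_a dPQ.
(* There are [#|V| + 1] labels, so one is free to name the part split off. *)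
have [c c_nf] : exists c, c \notin [set f x | x in V].
  apply/existsP; rewrite -negb_forall; apply/negP => /forallP all_f.
  have : (#|{: option V}| <= #|[set f x | x in V]|)%N.
    by apply/subset_leq_card/subsetP => c _; apply: all_f.
  by rewrite card_option ltnNge leq_imset_card.
have fc x : (f x == c) = false.
  by apply/eqP => fx; case/negP: c_nf; rewrite -fx imset_f.
have fP x : x \in P -> f x == a.
  by move=> xP; have := in_setU x P Q; rewrite eq_a xP inE.
have fQ x : x \in Q -> f x == a.
  by move=> xQ; have := in_setU x P Q; rewrite eq_a xQ orbT inE.
have fN x : x \notin P -> x \notin Q -> f x != a.
  move=> /negPf xP /negPf xQ; have := in_setU x P Q.
  by rewrite eq_a xP xQ inE => ->.
pose f' := [ffun x => if x \in P then c else f x].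
have := opt f'; rewrite -subr_ge0 (@score_diff f f' P Q) ?pmulr_rge0 // => u v.
rewrite !ffunE.
have [uP|uP] := boolP (u \in P); have [vP|vP] := boolP (v \in P).
- by rewrite !(disjointFr dPQ) // eqxx (eqP (fP u uP)) (eqP (fP v vP)) eqxx /=; ring.
- rewrite (eqP (fP u uP)) (eq_sym c) fc andbF (eq_sym a) /=.
  have [vQ|vQ] := boolP (v \in Q); first by rewrite fQ //=; ring.
  by rewrite (negPf (fN v vP vQ)) /=; ring.
- rewrite (eqP (fP v vP)) fc /=.
  have [uQ|uQ] := boolP (u \in Q); first by rewrite fQ //=; ring.
  by rewrite (negPf (fN u uP uQ)) /=; ring.
by rewrite andbF /=; ring.
Qed.

Let merge_le0 f a c : optimal f -> a != c -> W (cluster f a) (cluster f c) <= 0.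
Proof.
move=> opt nac.
pose f' := [ffun x => if f x == a then c else f x].
have := opt f'; rewrite -subr_le0.
rewrite (@score_diff f' f (cluster f a) (cluster f c)) ?pmulr_rle0 // => u v.
rewrite !ffunE !inE; have nca := negPf nac.
have [->|ua] := eqVneq (f u) a; have [->|va] := eqVneq (f v) a.
- by rewrite !eqxx nca /=; ring.
- by rewrite nca (eq_sym c) /=; ring.
- by rewrite (negPf ua) andbT /=; ring.
by rewrite subrr andbF addr0.
Qed.

(* Maximising the number of edges minus [theta] times the number of pairs
   inside clusters: splitting a cluster must not help, which bounds its cuts
   from below, and merging two clusters must not help, so that few edges run
   between clusters and each cluster is large. *)
Lemma clustering (delta : R) :
    (forall v, delta * #|V|%:R <= #|[set w | g v w]|%:R) -> 0 <= theta ->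
  exists cl : V -> option V,
    (forall P Q a, P :|: Q = [set v | cl v == a] -> [disjoint P & Q] ->
       theta * #|P|%:R * #|Q|%:R <=
         #|[set z : V * V | [&& z.1 \in P, z.2 \in Q & g z.1 z.2]]|%:R) /\
    (forall v, (delta - theta) * #|V|%:R <= #|[set w | cl w == cl v]|%:R).
Proof.
move=> deg th0.
have [f opt] : exists f, optimal f.
  case: (@arg_maxP _ _ _ [ffun=> None] xpredT score) => // f _ opt.
  by exists f => f'; apply: opt.
exists f; split=> [P Q a eq_a dPQ|v].
  by have := split_ge0 opt eq_a dPQ; rewrite W_card subr_ge0.
pose C := cluster f (f v); rewrite -/C.
have C_gt0 : 0 < #|C|%:R :> R.
  by rewrite ltr0n; apply/card_gt0P; exists v; rewrite inE.
(* The complement of [C] splits into the other clusters, none worth merging with [C]. *)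
have out_le0 : W C (~: C) <= 0.
  rewrite WC /W (partition_big f predT) //=; apply: sumr_le0 => a _.
  have [->|na] := eqVneq a (f v).
    by rewrite big_pred0 // => x; rewrite !inE andNb.
  rewrite (eq_bigl (mem (cluster f a))); first exact: merge_le0.
  move=> x; rewrite !inE andbC; case: eqP => // ->; exact: na.
have cardC' : W C C + W C (~: C) = W C setT.
  rewrite -big_split; apply: eq_bigr => u _ /=.
  by rewrite [RHS](bigID (mem C)) /=; congr (_ + _); apply: eq_bigl => v'; rewrite !inE.
have in_le : W C C <= #|C|%:R * #|C|%:R - theta * #|C|%:R * #|C|%:R.
  rewrite W_card lerD2r -natrM ler_nat -cardsX; apply/subset_leq_card/subsetP=> z.
  by rewrite !inE => /and3P[-> ->].
have tot_ge : (delta - theta) * #|V|%:R * #|C|%:R <= W C setT.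
  rewrite mulr_natr -sumr_const; apply: ler_sum => u _.
  rewrite sumrB sumr_const cardsT -[theta *+ _]mulr_natr mulrBl lerB //.
  apply: le_trans (deg u) _; rewrite -sum1_card natr_sum big_mkcond /=.
  rewrite [leRHS](eq_bigl predT); last by move=> v'; rewrite inE.
  by apply: ler_sum => v' _; rewrite inE; case: (g u v').
(* As [W C (~: C) <= 0], the total weight at [C] is at most [W C C], hence at most [#|C| ^+ 2]; it
   remains to divide by [#|C|]. *)
have : (delta - theta) * #|V|%:R * #|C|%:R <= #|C|%:R * #|C|%:R.
  have : 0 <= theta * #|C|%:R * #|C|%:R by rewrite !mulr_ge0.
  lra.
by rewrite ler_pM2r.
Qed.

End Clustering.

(** * Lower tails in the random graph *)

Section RandomGraph.
Variables (R : realType) (V : finType) (p : R).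
Hypothesis p01 : 0 <= p <= 1.
Implicit Types (H E : {set {set V}}).

Lemma Gnp_weight_ge0 H : 0 <= Gnp_weight p H.
Proof.
by case/andP: p01 => p0 p1; apply: prodr_ge0 => e _; case: ifP; rewrite ?subr_ge0.
Qed.

(** This is the expectation of one half to the power [#|H :&: E|]; by independence each edge of [E]
    contributes [p / 2 + (1 - p)]. *)
Lemma sum_Gnp_weight_half E : E \subset vpairs V ->
  \sum_(H : {set {set V}} | is_graph H) Gnp_weight p H * 2^-1 ^+ #|H :&: E| =
    (1 - p / 2) ^+ #|E|.
Proof.
move=> sE.
(* The value [0] off [vpairs V] removes the sets that are not graphs. *)
pose f e : R := if e \in vpairs V then p * (if e \in E then 2^-1 else 1) else 0.
pose g (e : {set V}) : R := if e \in vpairs V then 1 - p else 1.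
transitivity (\prod_(e : {set V}) (f e + g e)); last first.
  rewrite -prodr_const [RHS]big_mkcond; apply: eq_bigr => e _; rewrite /f /g.
  have [eE|_] := boolP (e \in E); first by rewrite (subsetP sE) //; field.
  by case: (e \in vpairs V); ring.
rewrite bigA_distr big_mkcond /=; apply: eq_bigr => H _.
case: ifPn => [gH|/subsetPn[e eH ne]]; last first.
  by rewrite (bigD1 e) //= eH /f (negPf ne) mul0r.
rewrite /Gnp_weight -prodr_const [X in X * _]big_mkcond [X in _ * X]big_mkcond.
rewrite -big_split; apply: eq_bigr => e _ /=; rewrite /f /g in_setI.
have [eH|neH] := boolP (e \in H); first by rewrite (subsetP gH).
by rewrite mulr1.
Qed.

(** Union bound with Markov's inequality: if [#|H :&: E j| <= b], then
    [2 ^+ b * 2^-1 ^+ #|H :&: E j|] is at least [1]. *)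
Lemma Gnp_prob_ge (J : finType) (A : {set J}) (E : J -> {set {set V}}) (b : nat)
    (P : {set {set V}} -> Prop) :
    {in A, forall j, E j \subset vpairs V} ->
    (forall H, is_graph H -> {in A, forall j, (b < #|H :&: E j|)%N} -> P H) ->
  1 - \sum_(j in A) 2 ^+ b * (1 - p / 2) ^+ #|E j| <= Gnp_prob p P.
Proof.
move=> sE PH; rewrite lerBlDr.
have := sum_Gnp_weight_half (sub0set (vpairs V)).
rewrite cards0 expr0 => total; rewrite -[leLHS]total.
rewrite (eq_bigr (fun j => \sum_(H : {set {set V}} | is_graph H)
    2 ^+ b * (Gnp_weight p H * 2^-1 ^+ #|H :&: E j|))); last first.
  by move=> j jA; rewrite -mulr_sumr sum_Gnp_weight_half ?sE.
rewrite [X in _ + X]exchange_big /= /Gnp_prob big_mkcondr -big_split /=.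
apply: ler_sum => H gH; rewrite setI0 cards0 expr0 mulr1.
have w0 := Gnp_weight_ge0 H.
have t0 j : 0 <= 2 ^+ b * (Gnp_weight p H * 2^-1 ^+ #|H :&: E j|).
  by rewrite !mulr_ge0 ?exprn_ge0 ?invr_ge0.
case: asboolP => [_|nP]; first by rewrite lerDl sumr_ge0.
rewrite add0r.
have [j jA le_b] : exists2 j, j \in A & (#|H :&: E j| <= b)%N.
  apply: contrapT => nj; apply: nP; apply: PH => // j jA.
  by rewrite ltnNge; apply/negP => le_b; apply: nj; exists j.
rewrite (bigD1 j) //=; apply: ler_wpDr; first by rewrite sumr_ge0.
rewrite mulrCA ler_peMr // -(subnK le_b) exprD -mulrA -exprMn divff ?pnatr_eq0 //.
by rewrite expr1n mulr1 exprn_ege1 // ler1n.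
Qed.

Lemma two_expn_mul_le (b m : nat) :
  2 ^+ b * (1 - p / 2) ^+ m <= expR (b%:R - p * m%:R / 2).
Proof.
case/andP: p01 => p0 p1.
rewrite expRD; apply: ler_pM; rewrite ?exprn_ge0 //; first by lra.
  rewrite -[b%:R]mulr1 expRM_natl lerXn2r ?nnegrE ?expR_ge0 //.
  by apply: le_trans (expR_ge1Dx _).
rewrite mulrAC; apply: expr_onem_le_expR; lra.
Qed.

End RandomGraph.

(** * Counting clusters and the edges between them *)

Section Classes.
Variables (V L : finType) (cl : V -> L).

Lemma card_between a c : a != c ->
  (#|[set v | cl v == a]| * #|[set v | cl v == c]| <=
    #|[set e in vpairs V | cl @: e == [set a; c]]|)%N.
Proof.
move=> nac; rewrite -cardsX.
have asym : {in setX [set v | cl v == a] [set v | cl v == c],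
    forall z, (z.2, z.1) \notin setX [set v | cl v == a] [set v | cl v == c]}.
  move=> z; rewrite !inE /= => /andP[/eqP z1 /eqP z2].
  by rewrite z2 (eq_sym c) (negPf nac).
rewrite -(card_in_imset (edge_inj asym)); apply/subset_leq_card/subsetP.
move=> e /imsetP[z]; rewrite !inE => /andP[/eqP z1 /eqP z2] ->.
have nz : z.1 != z.2 by apply: contraNneq nac => ez; rewrite -z1 -z2 ez.
by rewrite /edge imsetU1 imset_set1 z1 z2 eqxx cards2 nz.
Qed.

Lemma card_classes (R : realFieldType) (beta : R) : 0 < beta -> (0 < #|V|)%N ->
    (forall v, beta * #|V|%:R <= #|[set w | cl w == cl v]|%:R) ->
  #|cl @: [set: V]|%:R <= beta^-1.
Proof.
move=> b0 V0 large; rewrite -div1r ler_pdivlMr //.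
rewrite -(ler_pM2r (_ : 0 < #|V|%:R)) ?ltr0n // mul1r -mulrA.
rewrite mulr_natl -sumr_const.
have eqV : #|V| = (\sum_(a in cl @: [set: V]) #|[set w | cl w == a]|)%N.
  rewrite -[LHS]cardsT -sum1_card (partition_big_imset cl) /=.
  by apply: eq_bigr => a _; rewrite -sum1_card; apply: eq_bigl => v; rewrite !inE.
rewrite [in leRHS]eqV natr_sum; apply: ler_sum => _ /imsetP[v _ ->].
exact: large.
Qed.

End Classes.

(** * Colours, clusters and ownership in a dense graph *)

Lemma ordS3_asym (i j : 'I_3) : j = ordS i -> (i == ordS j) = false.
Proof. by move=> ->; apply/negbTE; case: i => [[|[|[|]]]]. Qed.

(* [D u v] means that [u] may offer the edge [uv]; it is read off a second
   colouring with three colours, so that no edge is owned by both ends. *)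
Lemma cluster_structure (R : realType) (alpha : R) (m : nat) : 0 < alpha ->
  exists beta gamma : R, [/\ 0 < beta, 0 < gamma & exists N : nat,
    forall n, (N <= n)%N -> forall (V : finType) (G : {set {set V}}),
      #|V| = n -> is_graph G ->
      (forall v, alpha * n%:R <= (degree G v)%:R) ->
    exists (chi : V -> 'I_m.+1) (cl : V -> option V) (D : rel V),
      [/\ forall u v, D u v -> ([set u; v] \in G) && ~~ D v u,
          forall u v, cl u = cl v -> chi u = chi v,
          forall u l, gamma * n%:R <= #|[set v | D u v && (chi v == l)]|%:R,
          forall u, gamma * n%:R <= #|[set v | D u v && (cl u == cl v)]|%:R &
          (forall v, beta * n%:R <= #|[set w | cl w == cl v]|%:R) /\
          (forall (P Q : {set V}) a, P :|: Q = [set v | cl v == a] ->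
             [disjoint P & Q] ->
             beta * #|P|%:R * #|Q|%:R <= #|cross G P Q|%:R)]].
Proof.
move=> a0.
have [gamma1 /andP[g1 _] [N1 N1P]] := balanced_colouring 1 m a0.
(* Half the degree density serves as [theta] in [clustering], so that [gamma1 - theta] is again
   [beta]. *)
pose beta := gamma1 / 2; have b0 : 0 < beta by rewrite divr_gt0.
pose gamma2 := Num.min gamma1 (beta ^+ 2 / 2).
have g2 : 0 < gamma2 by rewrite lt_min g1 divr_gt0 ?exprn_gt0.
have [gamma /andP[g0 _] [N2 N2P]] := balanced_colouring m.+2 2 g2.
have B0 : 0 <= 2 / beta by rewrite ltW ?divr_gt0.
exists beta, gamma; split=> //.
exists (N1 + N2 + Num.bound (2 / beta))%N => n le_n.
have [N1n N2n Bn] : [/\ N1 <= n, N2 <= n & Num.bound (2 / beta) <= n]%N.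
  by split; move: le_n; clear; lia.
move=> V G cV gG deg.
have n_beta : 2 <= beta * n%:R.
  rewrite mulrC -ler_pdivrMr //; apply/ltW/(lt_le_trans (archi_boundP B0)).
  by rewrite ler_nat.
have nbr_irr u : [set u; u] \notin G.
  by apply/negP => /(subsetP gG); rewrite inE setUid cards1.
pose nbr v := [set w | [set v; w] \in G].
have [||chi chiP] := N1P n N1n V V nbr.
- by rewrite cV mul1n.
- exact: deg.
(* Only monochromatic edges are clustered, so that clusters refine colours. *)
pose g : rel V := [rel v w | ([set v; w] \in G) && (chi w == chi v)].
have g_sym : symmetric g by move=> v w; rewrite /g /= setUC eq_sym.
have g_deg v : gamma1 * #|V|%:R <= #|[set w | g v w]|%:R.
  rewrite cV; apply: le_trans (chiP v (chi v)) _; rewrite ler_nat.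
  by apply/subset_leq_card/subsetP=> w; rewrite !inE.
have [cl [cut large]] := clustering g_sym g_deg (ltW b0).
have {}large v : beta * n%:R <= #|[set w | cl w == cl v]|%:R.
  by apply: le_trans (large v); rewrite cV (_ : _ - _ = beta) // /beta; field.
have cl_chi u v : cl u = cl v -> chi u = chi v.
  move=> euv; apply/eqP; apply: contraT => nuv; exfalso.
  (* Splitting a cluster by colour cuts no edge of [g], against the positive lower bound on cuts. *)
  pose P := [set w | (cl w == cl u) && (chi w == chi u)].
  pose Q := [set w | (cl w == cl u) && (chi w != chi u)].
  have ePQ : P :|: Q = [set w | cl w == cl u].
    by apply/setP=> w; rewrite !inE -andb_orr orbN andbT.
  have dPQ : [disjoint P & Q].
    by apply/pred0P=> w /=; rewrite !inE; case: (_ == _) => //=; case: (_ == _).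
  have no_edge : [set z | [&& z.1 \in P, z.2 \in Q & g z.1 z.2]] = set0.
    apply/setP=> z; rewrite /g !inE /=; apply/negbTE/negP.
    by case/and3P=> /andP[_ /eqP ->] /andP[_ /negPf ->]; rewrite andbF.
  have := cut P Q _ ePQ dPQ; rewrite no_edge cards0; apply/negP.
  have P0 : 0 < #|P|%:R :> R.
    by rewrite ltr0n; apply/card_gt0P; exists u; rewrite inE !eqxx.
  have Q0 : 0 < #|Q|%:R :> R.
    by rewrite ltr0n; apply/card_gt0P; exists v; rewrite inE euv eqxx eq_sym nuv.
  by rewrite -ltNge; apply: mulr_gt0 Q0; apply: mulr_gt0 P0.
have cl_deg v : beta ^+ 2 / 2 * n%:R <= #|nbr v :&: [set w | cl w == cl v]|%:R.
  pose W := [set w | cl w == cl v].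
  have vW : v \in W by rewrite inE.
  (* The cut between [v] and the rest of its cluster has at least [beta * (beta * n - 1)] edges, and
     [beta * n >= 2]. *)
  have := cut [set v] (W :\ v) (cl v); rewrite setD1K // => /(_ erefl).
  rewrite disjoints1 setD11 => /(_ isT).
  have := large v; rewrite -/W (cardsD1 v) vW natrD cards1 mulr1.
  set c := #|W :\ v|%:R; set e := #|_|%:R => Wge ce.
  have {}Wge : beta * n%:R <= 1 + c := Wge.
  apply: (@le_trans _ _ e).
    have h1 : beta * (beta * n%:R - 1) <= beta * c by rewrite ler_pM2l //; lra.
    have h2 : beta * 2 <= beta * (beta * n%:R) by rewrite ler_pM2l.
    by apply: le_trans ce; apply: le_trans h1; lra.
  rewrite /e ler_nat -[X in (_ <= X)%N](card_imset _ (_ : injective (fun w => (v, w))));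
    last by move=> ? ? [].
  apply/subset_leq_card/subsetP=> -[x y]; rewrite !inE /=.
  case/and3P=> /eqP -> /andP[_ yW] /andP[vy _]; apply/imsetP; exists y => //.
  by rewrite !inE vy.
(* Both kinds of neighbourhood form one family, so that a single colouring [r] balances them all. *)
pose F (i : V * option 'I_m.+1) := nbr i.1 :&:
  (if i.2 is Some l then [set w | chi w == l] else [set w | cl w == cl i.1]).
have [||r rP] := N2P n N2n V _ F.
- by rewrite card_prod card_option card_ord cV mulnC.
- have n0 := ler0n R n.
  case=> v [l|]; rewrite /F /=.
    apply: le_trans (chiP v l); rewrite ler_wpM2r // ge_min lexx //.
  by apply: le_trans (cl_deg v); rewrite ler_wpM2r // ge_min lexx orbT.
pose D : rel V := [rel u v | ([set u; v] \in G) && (r v == ordS (r u))].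
exists chi, cl, D; split=> //.
- move=> u v /andP[uv /eqP ruv]; rewrite uv /D /= setUC uv /=.
  by rewrite (ordS3_asym ruv).
- move=> u l; apply: le_trans (rP (u, Some l) (ordS (r u))) _; rewrite ler_nat.
  by apply/subset_leq_card/subsetP=> w; rewrite /F /D !inE /= => /andP[/andP[-> ->] ->].
- move=> u; apply: le_trans (rP (u, None) (ordS (r u))) _; rewrite ler_nat.
  apply/subset_leq_card/subsetP=> w; rewrite /F /D !inE /= => /andP[/andP[-> /eqP ->] ->].
  by rewrite eqxx.
split=> // P Q a ePQ dPQ; apply: le_trans (cut P Q a ePQ dPQ) _; rewrite ler_nat.
by apply/subset_leq_card/subsetP=> z; rewrite !inE => /and3P[-> -> /andP[]].
Qed.

(** Passes from densities to the integer thresholds of [waiter_wins_of_clusters], with [d] the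
    integer part of [gamma * n]. *)
Lemma clustered_waiter_wins (R : realType) (beta gamma c : R) (m n b : nat)
    (V : finType) (G H : {set {set V}}) (chi : V -> 'I_m.+1)
    (cl : V -> option V) (D : rel V) :
    0 < beta -> 0 < gamma -> c <= gamma / 4 -> c <= beta * gamma ^+ 2 / 16 ->
    4 <= gamma * n%:R -> (m.+1 < n)%N -> #|V| = n -> is_graph G -> is_graph H ->
    (1 <= b)%N -> b%:R <= c * n%:R ->
    (forall u v, D u v -> ([set u; v] \in G) && ~~ D v u) ->
    (forall u v, cl u = cl v -> chi u = chi v) ->
    (forall u l, gamma * n%:R <= #|[set v | D u v && (chi v == l)]|%:R) ->
    (forall u, gamma * n%:R <= #|[set v | D u v && (cl u == cl v)]|%:R) ->
    (forall (P Q : {set V}) a, P :|: Q = [set v | cl v == a] ->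
       [disjoint P & Q] -> beta * #|P|%:R * #|Q|%:R <= #|cross G P Q|%:R) ->
    (forall u v, cl u != cl v ->
       (b < #|H :&: [set e in vpairs V | cl @: e == [set cl u; cl v]]|)%N) ->
  waiter_wins (G :|: H) b (spanning_k_connected (G :|: H) m.+1).
Proof.
move=> b0 g0 c_g c_bg n4 mn cV gG gH b1 bc D_sub cl_chi D_col D_cl cut Hcross.
have n0 : 1 <= n%:R :> R by rewrite ler1n (leq_trans _ mn).
have gn_ge0 : 0 <= gamma * n%:R by lra.
have bR1 : 1 <= b%:R :> R by rewrite ler1n.
have bg : b%:R <= gamma / 4 * n%:R by apply: le_trans bc _; rewrite ler_pM2r //; lra.
pose d := Num.trunc (gamma * n%:R).
have /andP[d_le d_gt] := truncn_itv gn_ge0; rewrite -/d in d_le d_gt.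
apply: (@waiter_wins_of_clusters V (option V) m.+1 b d G (G :|: H) chi cl D).
- by rewrite cV.
- exact: subsetUl.
- by rewrite /is_graph subUset; apply/andP.
- exact: D_sub.
- exact: cl_chi.
- move=> u l; rewrite -(ltr_nat R); apply: lt_le_trans (D_col u l); lra.
- by move=> u; rewrite -(ler_nat R); apply: le_trans d_le (D_cl u).
- move=> P Q a ePQ dPQ dP dQ.
  (* From [d > gamma * n - 1], [b <= gamma * n / 4] and [gamma * n >= 4]. *)
  have half S : (d <= #|S : {set V}| + b)%N -> gamma / 2 * n%:R <= #|S|%:R.
    by rewrite -(ler_nat R) natrD -(lerD2r 1) natr1 => dS; lra.
  rewrite -(ler_nat R); apply: le_trans (cut P Q a ePQ dPQ).
  have PQ : (gamma / 2 * n%:R) * (gamma / 2 * n%:R) <= #|P|%:R * #|Q|%:R.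
    by apply: ler_pM; rewrite ?half //; lra.
  rewrite -mulrA; apply: le_trans (ler_wpM2l (ltW b0) PQ).
  rewrite natrM cV -[n.+1%:R]natr1 -[b.+1%:R]natr1.
  (* Here [n + 1 <= 2 * n] and [b + 1 <= 2 * b <= 2 * (c * n)]; the bound [c_bg] absorbs the factor
     [4]. *)
  apply: (@le_trans _ _ ((2 * n%:R) * (2 * (c * n%:R)))).
    by apply: ler_pM; lra.
  have n2 : 0 <= n%:R * n%:R :> R by rewrite mulr_ge0.
  have := ler_wpM2r n2 c_bg; lra.
move=> u v /eqP ncl _; apply: leq_trans (Hcross u v ncl) _.
apply/subset_leq_card/subsetP=> e; rewrite !inE.
by case/and3P=> -> _ ->; rewrite orbT.
Qed.

(** * Constants and the final probability bound *)

Theorem theorem1p7 (R : realType) (alpha : R) (k : nat)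
    (alpha_gt0 : 0 < alpha) (k_ge1 : (1 <= k)%N) :
  exists C c : R, [/\ 0 < C, 0 < c &
    exists N : nat, forall n : nat, (N <= n)%N ->
    forall (V : finType) (G : {set {set V}}) (b : nat) (p : R),
      #|V| = n ->
      is_graph G ->
      (forall v : V, alpha * n%:R <= (degree G v)%:R) ->
      (1 <= b)%N -> b%:R <= c * n%:R ->
      0 <= p <= 1 -> C * b%:R / n%:R ^+ 2 <= p ->
      1 - expR (- (c * p * n%:R ^+ 2)) <=
        Gnp_prob p (fun H : {set {set V}} =>
          waiter_wins (G :|: H) b (spanning_k_connected (G :|: H) k))].
Proof.
case: k k_ge1 => // m _.
have [beta [gamma [b0 g0 [N0 structure]]]] := cluster_structure m alpha_gt0.
(* Bounds the number of cluster pairs, as there are at most [beta^-1] clusters. *)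
pose kappa := beta^-1 * beta^-1.
have k0 : 0 < kappa by rewrite mulr_gt0 ?invr_gt0.
have kb : kappa * beta ^+ 2 = 1 by rewrite /kappa; field; rewrite gt_eqF.
(* Chosen so that [beta ^+ 2 / 4 * C = kappa + 1]: of the exponent [beta ^+ 2 / 2 * t], one half
   pays for [kappa + b] and the other is at least [c * t]. *)
pose C := 4 * kappa * (kappa + 1).
pose c := Num.min (gamma / 4) (Num.min (beta * gamma ^+ 2 / 16) (beta ^+ 2 / 4)).
exists C, c; split.
- have k1 : 0 < kappa + 1 by lra.
  by apply: mulr_gt0 k1; apply: mulr_gt0 k0; rewrite ltr0n.
- by rewrite /c !lt_min; apply/and3P; split; rewrite divr_gt0 ?mulr_gt0 ?exprn_gt0 ?ltr0n.
have c1 : c <= gamma / 4 by rewrite ge_min lexx.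
have c2 : c <= beta * gamma ^+ 2 / 16 by rewrite !ge_min lexx orbT.
have c3 : c <= beta ^+ 2 / 4 by rewrite !ge_min lexx !orbT.
have B0 : 0 <= 4 / gamma by rewrite ltW ?divr_gt0.
exists (N0 + Num.bound (4 / gamma) + m.+2)%N => n le_n.
have [N0n Bn mn] : [/\ N0 <= n, Num.bound (4 / gamma) <= n & m.+1 < n]%N.
  by split; move: le_n; clear; lia.
move=> V G b p cV gG deg b1 bc p01 Cp.
have n4 : 4 <= gamma * n%:R.
  rewrite mulrC -ler_pdivrMr //; apply/ltW/(lt_le_trans (archi_boundP B0)).
  by rewrite ler_nat.
have n0 : 0 < n%:R :> R by rewrite ltr0n (leq_trans _ mn).
have [chi [cl [D [D_sub cl_chi D_col D_cl [large cut]]]]] :=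
  structure n N0n V G cV gG deg.
pose J := [set [set cl z.1; cl z.2] | z in [set z : V * V | cl z.1 != cl z.2]].
pose E (j : {set option V}) := [set e in vpairs V | cl @: e == j].
have : 1 - \sum_(j in J) 2 ^+ b * (1 - p / 2) ^+ #|E j| <=
    Gnp_prob p (fun H : {set {set V}} =>
      waiter_wins (G :|: H) b (spanning_k_connected (G :|: H) m.+1)).
  apply: Gnp_prob_ge => // [j _|H gH Hj].
    by apply/subsetP=> e; rewrite !inE => /andP[].
  apply: (clustered_waiter_wins b0 g0 c1 c2 n4 mn cV gG gH b1 bc D_sub cl_chi
    D_col D_cl cut).
  by move=> u v nuv; apply: Hj; apply/imsetP; exists (u, v); rewrite ?inE.
apply: le_trans; rewrite lerD2l lerN2.
pose t := p * n%:R ^+ 2.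
have term_le j : j \in J ->
    2 ^+ b * (1 - p / 2) ^+ #|E j| <= expR (b%:R - beta ^+ 2 / 2 * t).
  move=> /imsetP[z]; rewrite inE => nz ->.
  apply: le_trans (two_expn_mul_le p01 b _) _; rewrite ler_expR lerD2l lerN2.
  have Ege : (beta * n%:R) * (beta * n%:R) <= #|E [set cl z.1; cl z.2]|%:R.
    apply: le_trans (_ : (#|[set v | cl v == cl z.1]| *
      #|[set v | cl v == cl z.2]|)%N%:R <= _); last by rewrite ler_nat card_between.
    by rewrite natrM; apply: ler_pM; rewrite ?mulr_ge0 ?large // ltW.
  case/andP: p01 => p0 _; have := ler_wpM2l p0 Ege; rewrite /t; lra.
have card_J : #|J|%:R <= kappa.
  have C_le : #|cl @: [set: V]|%:R <= beta^-1.
    by apply: card_classes; rewrite // cV ?large // (leq_trans _ mn).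
  apply: le_trans (_ : (#|cl @: [set: V]| * #|cl @: [set: V]|)%N%:R <= _); last first.
    by rewrite natrM; apply: ler_pM.
  rewrite ler_nat -cardsX.
  apply: leq_trans (leq_imset_card (fun x => [set x.1; x.2]) _).
  apply/subset_leq_card/subsetP=> _ /imsetP[z _ ->].
  apply/imsetP; exists (cl z.1, cl z.2) => //.
  by rewrite in_setX; apply/andP; split; apply: imset_f; rewrite inE.
apply: le_trans (ler_sum _ term_le) _.
rewrite sumr_const -[leLHS]mulr_natl.
(* [kappa <= expR kappa] moves the number of pairs into the exponent. *)
apply: (@le_trans _ _ (expR kappa * expR (b%:R - beta ^+ 2 / 2 * t))).
  rewrite ler_pM2r ?expR_gt0 //; apply: le_trans card_J _.
  by apply: le_trans (expR_ge1Dx kappa); lra.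
rewrite -expRD ler_expR -[c * p * _]mulrA -/t.
have bR1 : 1 <= b%:R :> R by rewrite ler1n.
have t_ge : C * b%:R <= t by rewrite /t -ler_pdivrMr ?exprn_gt0.
have t0 : 0 <= t.
  by case/andP: p01 => p0 _; rewrite /t mulr_ge0 // exprn_ge0 // ltW.
have ct : c * t <= beta ^+ 2 / 4 * t by rewrite ler_wpM2r.
have bt : (kappa + 1) * b%:R <= beta ^+ 2 / 4 * t.
  apply: le_trans (_ : beta ^+ 2 / 4 * (C * b%:R) <= _); last first.
    by rewrite ler_wpM2l // divr_ge0 ?exprn_ge0 // ltW.
  rewrite (_ : _ / 4 * _ = (kappa * beta ^+ 2) * ((kappa + 1) * b%:R)).
    by rewrite kb mul1r.
  by rewrite /C; field.
have kb1 : kappa <= kappa * b%:R by rewrite ler_peMr // ltW.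
lra.
Qed.
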